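(* Let $s\in\mathbb{N}_0$, $h\in\mathbb{C}\setminus\{0\}$, $p,q\in\mathbb{C}$, and let $X,Y,Z_p$ satisfy the commutation relations of the $(p,q)$-deformed generalized Weyl algebra $A_{s;h|p,q}$. Then, for every $m\in\mathbb{N}$, the binomial $(X+Y)^m$ can be written in normal ordered form as $$(X+Y)^m=\sum_{\ell=0}^m\sum_{k=0}^{\ell}h^k\,\mathcal{J}_{s,p,q}(m,\ell,k)\,Y^{m-\ell+(s-1)k}Z_p^{k}X^{\ell-k},$$ where $\mathcal{J}_{s,p,q}(m,0,k)=1$ and, for $\ell\neq 0$, $$\mathcal{J}_{s,p,q}(m,\ell,k)=\sum_{\substack{\mathbf{k}\in\{0,1\}^{\ell}\\ |\mathbf{k}|=k}}p^{\mathcal{P}^{\ast}_{\ell}(\mathbf{k})}\sum_{\lambda\in\mathcal{I}_{m-\ell,\ell}}q^{\mathcal{Q}^{\ast}_{\ell|s}(\mathbf{n}_\lambda,\mathbf{k})}\,\mathcal{A}_{\ell|s;p,q}(\mathbf{n}_\lambda,\mathbf{k}).$$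
   Context: $\mathbb{N}_0=\{0,1,2,\dots\}$. The algebra $A_{s;h|p,q}$ is the complex unital associative algebra generated by $X,Y,Z_p$ with relations $XY-qYX=hY^sZ_p$, $Z_pY=pYZ_p$, $XZ_p=pZ_pX$, and $Z_1=I$ (i.e. $Z_p$ is the identity when $p=1$). For $a,b\in\mathbb{N}_0$, $\mathcal{I}_{a,b}$ is the set of integer sequences $\lambda=(\lambda_1,\dots,\lambda_b)$ with $a\ge\lambda_1\ge\cdots\ge\lambda_b\ge 0$. For $\lambda\in\mathcal{I}_{m-\ell,\ell}$ the vector $\mathbf{n}_\lambda=(n_1,\dots,n_\ell)$ consists of the numbers $n_l=\lambda_{\ell-l+1}-\lambda_{\ell-l+2}$, $1\le l\le\ell$, with $\lambda_{\ell+1}:=0$; thus $\sum_{l=1}^{j}n_l=\lambda_{\ell-j+1}$. For $\mathbf{k}=(k_1,\dots,k_\ell)$, $|\mathbf{k}|=k_1+\cdots+k_\ell$. $[n]_{p,q}=\frac{p^n-q^n}{p-q}=\sum_{k=1}^n p^{n-k}q^{k-1}$ (the last expression is used when $p=q$), $[0]_{p,q}=0$. For $\mathbf{n},\mathbf{k}$ of length $r$, $$\mathcal{P}^{\ast}_r(\mathbf{k})=\sum_{j=1}^{r-1}(1-k_{j+1})\sum_{l=1}^{j}k_l,\qquad \mathcal{Q}^{\ast}_{r|s}(\mathbf{n},\mathbf{k})=\sum_{j=1}^{r}(1-k_j)\Big\{\sum_{l=1}^{j}n_l+(s-1)\sum_{l=1}^{j-1}k_l\Big\},$$ $$\mathcal{A}_{r|s;p,q}(\mathbf{n},\mathbf{k})=\prod_{j=1}^{r}\prod_{i=0}^{k_j-1}\Big[\sum_{l=1}^{j}n_l+(s-1)\sum_{l=1}^{j-1}k_l+(s-1)i\Big]_{p,q}.$$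 Conventions: empty products equal $1$, $0^0=1$; a summand $(\mathbf{k},\lambda)$ in which $\mathcal{A}$ contains a factor $[0]_{p,q}$ is taken to be $0$ (this covers every case, possible only for $s=0$, in which a negative integer appears inside a bracket or as a contribution to the exponent of $q$); a term of the expansion with coefficient $0$ is omitted even if the formal exponent of $Y$ is negative. *)

(* Defs.v *)
From HB Require Import structures.
From mathcomp Require Import all_boot all_order all_algebra.
From mathcomp Require Import zify.
From mathcomp Require Import reals complex.

Set Implicit Arguments.
Unset Strict Implicit.
Unset Printing Implicit Defensive.
Import Order.TTheory GRing.Theory Num.Theory.
Local Open Scope ring_scope.

(* Vectors (v_1, ..., v_r) are functions on 'I_r: v_j is v (j - 1), so that
   \sum_(l < r | l <= j) v l is v_1 + ... + v_{j+1} for j : 'I_r. *)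

Definition gweyl_rel (C : fieldType) (A : algType C) (s : nat) (h p q : C)
    (X Y Z : A) : Prop :=
  [/\ X * Y - q *: (Y * X) = h *: (Y ^+ s * Z),
      Z * Y = p *: (Y * Z),
      X * Z = p *: (Z * X)
    & p = 1 -> Z = 1].

Definition pqnum (C : fieldType) (p q : C) (n : nat) : C :=
  \sum_(1 <= k < n.+1) p ^+ (n - k) * q ^+ k.-1.

Lemma pqnumE (C : fieldType) (p q : C) (n : nat) :
  p != q -> pqnum p q n = (p ^+ n - q ^+ n) / (p - q).
Proof.
move=> pNq; have pq0 : p - q != 0 by rewrite subr_eq0.
apply: (mulIf pq0); rewrite divfK // subrXX [RHS]mulrC /pqnum big_add1 big_mkord.
by congr (_ * _); apply: eq_bigr => i _; rewrite subnS predn_sub.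
Qed.

(* The value at negative integers is irrelevant: whenever a bracket of a
   negative integer occurs in Acoef below, so does a factor [0] = 0. *)
Definition pqbracket (C : fieldType) (p q : C) (n : int) : C :=
  match n with Posz a => pqnum p q a | Negz _ => 0 end.

(* The sum over 1 <= j <= r - 1 of (1 - k_{j+1}) (k_1 + ... + k_j) is indexed
   here by j + 1; the additional first summand has an empty inner sum. *)
Definition Pstar (r : nat) (k : 'I_r -> nat) : int :=
  \sum_(j < r) (1 - (k j)%:Z) * \sum_(l < r | (l < j)%N) (k l)%:Z.

Definition Qstar (r s : nat) (n k : 'I_r -> nat) : int :=
  \sum_(j < r) (1 - (k j)%:Z) *
    (\sum_(l < r | (l <= j)%N) (n l)%:Z
     + (s%:Z - 1) * \sum_(l < r | (l < j)%N) (k l)%:Z).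

Definition Acoef (C : fieldType) (r s : nat) (p q : C) (n k : 'I_r -> nat) : C :=
  \prod_(j < r) \prod_(i < k j)
    pqbracket p q (\sum_(l < r | (l <= j)%N) (n l)%:Z
                   + (s%:Z - 1) * \sum_(l < r | (l < j)%N) (k l)%:Z
                   + (s%:Z - 1) * i%:Z).

Definition Iseq (a b : nat) : {set b.-tuple 'I_a.+1} :=
  [set lam : b.-tuple 'I_a.+1 | sorted geq (map val lam)].

(* lambda_t is nth ord0 lam (t - 1), so the default value encodes
   lambda_{b+1} := 0; the truncated subtraction is exact on Iseq a b. *)
Definition nvec (a b : nat) (lam : b.-tuple 'I_a.+1) (i : 'I_b) : nat :=
  (nth ord0 lam (b - i.+1) - nth ord0 lam (b - i))%N.

Lemma sum_nvec (a b : nat) (lam : b.-tuple 'I_a.+1) (t : nat) :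
  lam \in Iseq a b -> (t <= b)%N ->
  (\sum_(i < b | (i < t)%N) nvec lam i)%N = nth ord0 lam (b - t).
Proof.
rewrite inE => lam_sorted; elim: t => [_|t IHt ltb].
  by rewrite big_pred0 // subn0 nth_default // size_tuple.
have -> : (\sum_(i < b | (i < t.+1)%N) nvec lam i)%N =
    (nvec lam (Ordinal ltb) + \sum_(i < b | (i < t)%N) nvec lam i)%N.
  rewrite (bigD1 (Ordinal ltb)) //=; congr addn.
  by apply: eq_bigl => i; rewrite -val_eqE /= ltnS ltn_neqAle andbC.
rewrite IHt ?(ltnW ltb) // /nvec /= subnK //.
have [->|t_gt0] := posnP t.
  by rewrite subn0 [nth _ _ b]nth_default ?size_tuple // subn0 addn0.
have geq_trans : transitive geq by move=> x y z /= xy zx; apply: leq_trans xy.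
have := sorted_leq_nth geq_trans leqnn 0%N lam_sorted (b - t.+1)%N (b - t)%N.
rewrite !inE size_map size_tuple !(nth_map ord0) ?size_tuple; try lia.
by apply; lia.
Qed.

(* Exponents are integers and ^ is the total power of the field C. A negative
   exponent of q only occurs together with a factor [0] = 0 of Acoef, in which
   case the summand is 0. *)
Definition Jcoef (C : fieldType) (s : nat) (p q : C) (m l k : nat) : C :=
  if l == 0%N then 1
  else \sum_(kk : {ffun 'I_l -> 'I_2} | (\sum_(j < l) kk j)%N == k)
         p ^ Pstar (fun j => kk j) *
         \sum_(lam in Iseq (m - l) l)
           q ^ Qstar s (nvec lam) (fun j => kk j) *
           Acoef s p q (nvec lam) (fun j => kk j).

(* The exponent m - l + (s - 1) k of Y can only be negative if the coefficient
   vanishes, so that it may be computed in nat. *)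
Lemma Jcoef_eq0 (C : fieldType) (s : nat) (p q : C) (m l k : nat) :
  (k <= l)%N -> (m - l)%:Z + (s%:Z - 1) * k%:Z < 0 -> Jcoef s p q m l k = 0.
Proof.
move=> le_kl neg.
have s0 : s = 0%N by case: s neg => // s; nia.
have {neg} lt_k : (m - l < k)%N by move: neg; rewrite s0; lia.
rewrite /Jcoef; case: eqP => [l0|_]; first by move: lt_k; rewrite l0 in le_kl *; lia.
apply: big1 => kk /eqP sum_kk; rewrite big1 ?mulr0 // => lam lamI.
suff -> : Acoef s p q (nvec lam) (fun j => kk j) = 0 by rewrite mulr0.
pose N t := (\sum_(i < l | (i < t)%N) nvec lam i)%N.
pose K t := (\sum_(i < l | (i < t)%N) kk i)%N.
have addS (f : 'I_l -> nat) (j : 'I_l) :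
    (\sum_(i < l | (i < j.+1)%N) f i)%N = (f j + \sum_(i < l | (i < j)%N) f i)%N.
  rewrite (bigD1 j) //=; congr addn.
  by apply: eq_bigl => i; rewrite -val_eqE /= ltnS ltn_neqAle andbC.
have [/existsP[j /andP[/eqP kj1 /eqP NK]]|no_zero] :=
    boolP [exists j : 'I_l, (kk j == 1%N :> nat) && (N j.+1 == K j)].
  rewrite /Acoef (bigD1 j) //= kj1 big_ord1 mulr0 addr0 s0.
  suff -> : \sum_(i < l | (i <= j)%N) (nvec lam i)%:Z +
      (0%:Z - 1) * \sum_(i < l | (i < j)%N) (kk i)%:Z = 0.
    by rewrite /= /pqnum big_geq // mul0r.
  rewrite -!(big_morph Posz PoszD (erefl 0%:Z)) -[X in _ + _ * X%:Z]/(K j).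
  by rewrite -NK /N sub0r mulN1r subrr.
have le_KN t : (t <= l)%N -> (K t <= N t)%N.
  elim: t => [_|t IHt lt_tl]; first by rewrite /K big_pred0.
  have {}IHt := IHt (ltnW lt_tl); set j := Ordinal lt_tl.
  have /existsPn/(_ j) := no_zero; rewrite negb_and /=.
  have -> : K t.+1 = (kk j + K t)%N by exact: (addS _ j).
  have NS : N t.+1 = (nvec lam j + N t)%N by exact: (addS _ j).
  have := ltn_ord (kk j); case: (nat_of_ord (kk j)) => [|[|//]] _ /=.
    by rewrite NS; lia.
  by move: NS IHt; lia.
exfalso; have := le_KN l (leqnn l).
have -> : K l = k.
  by rewrite -sum_kk; apply: eq_bigl => i; rewrite ltn_ord.
rewrite /N sum_nvec // subnn.
move=> le_k; have := leq_trans le_k (leq_ord (nth ord0 lam 0)).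
by rewrite leqNgt lt_k.
Qed.

(* Main.v *)
Require Import Defs.
From HB Require Import structures.
From mathcomp Require Import all_boot all_order all_algebra.
From mathcomp Require Import zify.
From mathcomp Require Import reals complex.

(* Let U(a, l) be the sum of all words with l letters X and a letters Y. Splitting
   off the first letter gives U(a+1, l+1) = Y U(a, l+1) + X U(a+1, l), and moving X
   to the right of Y^e Z^k costs
     X Y^e Z^k = p^k q^e Y^e Z^k X + h [e] Y^(e+s-1) Z^(k+1).
   The coefficients satisfy the matching recurrence: lambda_1 = t is the number
   of letters Y to the right of the leftmost X, and the last entry of the vector
   k records whether this X survives. *)

Set Implicit Arguments.
Unset Strict Implicit.
Unset Printing Implicit Defensive.
Import Order.TTheory GRing.Theory Num.Theory.
Local Open Scope ring_scope.

(** * Moving X across normally ordered monomials *)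

Lemma pqnum0 (C : fieldType) (p q : C) : pqnum p q 0 = 0.
Proof. by rewrite /pqnum big_geq. Qed.

Lemma pqnumS (C : fieldType) (p q : C) (n : nat) :
  pqnum p q n.+1 = q ^+ n + p * pqnum p q n.
Proof.
rewrite /pqnum big_nat_recr //= subnn mul1r addrC; congr (_ + _).
rewrite big_distrr /=; apply: eq_big_nat => k /andP[_ lt_kn].
by rewrite mulrA -exprS subSn.
Qed.

Section Commutation.
Variables (C : fieldType) (A : algType C) (s : nat) (h p q : C) (X Y Z : A).
Hypothesis rel : gweyl_rel s h p q X Y Z.

Lemma gweyl_X_Yn (n : nat) :
  X * Y ^+ n =
  q ^+ n *: (Y ^+ n * X) + (h * pqnum p q n) *: (Y ^+ (n + s).-1 * Z).
Proof.
case: rel => /eqP; rewrite subr_eq addrC => /eqP XY ZY _ _.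
elim: n => [|n IHn]; first by rewrite pqnum0 mulr0 !scale0r addr0 mulr1 scale1r mul1r.
rewrite exprSr mulrA {}IHn mulrDl -!scalerAl -!mulrA XY ZY.
rewrite mulrDr scalerDr -!scalerAr !scalerA -addrA addSn /=.
congr (_ + _); first by rewrite !mulrA -!exprSr.
rewrite !mulrA -exprD pqnumS mulrDr scalerDl (mulrC h (q ^+ n)); congr (_ + _).
(* The exponent [(n + s).-1] can truncate only for n = 0, where the bracket vanishes. *)
case: n => [|n]; first by rewrite pqnum0 !(mulr0, mul0r, scale0r).
by rewrite -exprSr addSn /= -mulrA (mulrC _ p).
Qed.

Lemma gweyl_X_Zn (n : nat) : X * Z ^+ n = p ^+ n *: (Z ^+ n * X).
Proof.
case: rel => _ _ XZ _; elim: n => [|n IHn]; first by rewrite scale1r mulr1 mul1r.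
by rewrite exprSr mulrA {}IHn -scalerAl -(mulrA _ X) XZ -scalerAr scalerA mulrA -!exprSr.
Qed.

Lemma gweyl_X_monomial (a b c : nat) :
  X * (Y ^+ a * Z ^+ b * X ^+ c) =
  (p ^+ b * q ^+ a) *: (Y ^+ a * Z ^+ b * X ^+ c.+1) +
  (h * pqnum p q a) *: (Y ^+ (a + s).-1 * Z ^+ b.+1 * X ^+ c).
Proof.
rewrite !mulrA gweyl_X_Yn !mulrDl -!scalerAl -!mulrA (mulrA X) gweyl_X_Zn.
by rewrite -!scalerAl -!scalerAr scalerA (mulrC (q ^+ a)) -!mulrA -exprS (mulrA Z) -exprS.
Qed.

End Commutation.

(** * Sums over weakly decreasing sequences *)

Section SequenceSums.
Variable V : nmodType.

(** The largest entry is chosen first and bounds the rest, so that unfolding once exposes the sum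
    over lambda_1. *)
Fixpoint rsum (l a : nat) (F : seq nat -> V) : V :=
  if l is l'.+1 then \sum_(t < a.+1) rsum l' t (fun x => F (val t :: x))
  else F [::].

(** The type bound [b] stays fixed while [a] drops along the induction. *)
Lemma sum_tuple_path (b l a : nat) (F : seq nat -> V) : (a <= b)%N ->
  \sum_(x : l.-tuple 'I_b.+1 | path geq a (map val x)) F (map val x) =
  rsum l a F.
Proof.
elim: l a F => [|l IHl] a F leab /=.
  rewrite (big_pred1 [tuple]) // => x; by rewrite tuple0.
pose f (u : 'I_b.+1 * l.-tuple 'I_b.+1) := [tuple of u.1 :: u.2].
rewrite (reindex f) /=; last first.
  exists (fun x => (thead x, [tuple of behead x])) => [[t x] _|x _].
    by congr pair; apply: val_inj.
  by rewrite /f /= -tuple_eta.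
rewrite (eq_bigl (fun u : 'I_b.+1 * l.-tuple 'I_b.+1 =>
   (u.1 < a.+1)%N && path geq u.1 (map val u.2))); last by case=> t x.
rewrite -(pair_big_dep (fun t : 'I_b.+1 => (t < a.+1)%N)
   (fun t (x : l.-tuple 'I_b.+1) => path geq t (map val x))
   (fun t x => F (val t :: map val x))) /=.
rewrite (big_ord_widen b.+1 (fun t => rsum l t (fun x => F (t :: x)))) //.
by apply: eq_bigr => t _; rewrite -(IHl t (fun x => F (val t :: x))) ?leq_ord.
Qed.

Lemma sum_Iseq (a l : nat) (F : seq nat -> V) :
  \sum_(x in Iseq a l) F (map val x) = rsum l a F.
Proof.
rewrite -(@sum_tuple_path a) //; apply: eq_bigl => x; rewrite inE.
by case: (tval x) => //= t y; rewrite leq_ord.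
Qed.

End SequenceSums.

Lemma rsum_mulr (R : pzRingType) (l a : nat) (F : seq nat -> R) (c : R) :
  rsum l a (fun x => F x * c) = rsum l a F * c.
Proof.
elim: l a F => //= l IHl a F; rewrite big_distrl /=.
by apply: eq_bigr => t _; rewrite IHl.
Qed.

Lemma eq_rsum (V : nmodType) (l a : nat) (F G : seq nat -> V) :
  F =1 G -> rsum l a F = rsum l a G.
Proof.
elim: l a F G => /= [|l IHl] a F G FG; first exact: FG.
by apply: eq_bigr => t _; apply: IHl => x; apply: FG.
Qed.

(** * Splitting off the last coordinate of a vector *)

Definition ffun_rcons (l : nat) (T : finType) (g : {ffun 'I_l -> T}) (e : T) :
    {ffun 'I_l.+1 -> T} :=
  [ffun i => if unlift ord_max i is Some j then g j else e].

Lemma ffun_rcons_max (l : nat) (T : finType) (g : {ffun 'I_l -> T}) (e : T) :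
  ffun_rcons g e ord_max = e.
Proof. by rewrite ffunE unlift_none. Qed.

Lemma ffun_rcons_lift (l : nat) (T : finType) (g : {ffun 'I_l -> T}) (e : T)
    (j : 'I_l) :
  ffun_rcons g e (lift ord_max j) = g j.
Proof. by rewrite ffunE liftK. Qed.

Lemma sum_ffun_recr (V : nmodType) (l : nat) (T : finType)
    (P : pred {ffun 'I_l.+1 -> T}) (F : {ffun 'I_l.+1 -> T} -> V) :
  \sum_(f | P f) F f =
  \sum_e \sum_(g | P (ffun_rcons g e)) F (ffun_rcons g e).
Proof.
rewrite pair_big_dep /=.
rewrite (reindex (fun u : T * {ffun 'I_l -> T} => ffun_rcons u.2 u.1)) //.
exists (fun f : {ffun 'I_l.+1 -> T} =>
          (f ord_max, [ffun j : 'I_l => f (lift ord_max j)])) => [[e g] _|f _] /=.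
  rewrite ffun_rcons_max; congr pair; apply/ffunP => j.
  by rewrite ffunE ffun_rcons_lift.
by apply/ffunP => i; rewrite ffunE; case: unliftP => [j ->|-> //]; rewrite ffunE.
Qed.

Lemma lift_max_widen (l : nat) (j : 'I_l) : widen_ord (leqnSn l) j = lift ord_max j.
Proof. by apply: val_inj; rewrite /= /bump leqNgt ltn_ord. Qed.

(** * The coefficients as sums of weights, and their recurrence *)

Section Weights.
Variables (C : fieldType) (s : nat) (p q : C).

(* The factor produced when X passes Y^(N + (s-1) K) Z^K: X survives (e = 0) or
   is turned into one more Z (e = 1). The truncated subtraction is exact
   whenever the weight of the summand is nonzero. *)
Definition pass_weight (e K N : nat) : C :=
  if e == 0%N then p ^+ K * q ^+ (N + s * K - K) else pqnum p q (N + s * K - K).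

(** The letters X are processed from right to left, so coordinate [j] reads [x] from its end: for
    [x] in [Iseq] that entry is n_1 + ... + n_{j+1}, the number of letters Y to the right of this
    X. *)
Definition word_weight (l : nat) (k : 'I_l -> nat) (x : seq nat) : C :=
  \prod_(j < l) pass_weight (k j) (\sum_(i < l | (i < j)%N) k i)
                            (nth 0%N x (l - j.+1)).

Lemma word_weightS (l : nat) (k : 'I_l.+1 -> nat) (t : nat) (x : seq nat) :
  word_weight k (t :: x) =
  word_weight (fun j => k (lift ord_max j)) x *
  pass_weight (k ord_max) (\sum_j k (lift ord_max j)) t.
Proof.
rewrite /word_weight big_ord_recr /= subnn /=; congr (_ * _).
  apply: eq_bigr => j _; rewrite lift_max_widen subSS; congr (pass_weight _ _ _).
    rewrite big_mkcond big_ord_recr /= ltnNge ltnW // addn0 [RHS]big_mkcond.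
    by apply: eq_bigr => i _; rewrite lift_max_widen.
  by rewrite subnS; case: (l - j)%N (subn_gt0 j l) => //=; rewrite ltn_ord.
congr (pass_weight _ _ _); rewrite big_mkcond big_ord_recr /= ltnn addn0.
by apply: eq_bigr => i _; rewrite ltn_ord lift_max_widen.
Qed.

Lemma sum_ord_ltS (l : nat) (f : 'I_l -> nat) (j : 'I_l) :
  (\sum_(i < l | (i < j.+1)%N) f i = f j + \sum_(i < l | (i < j)%N) f i)%N.
Proof.
rewrite (bigD1 j) //=; congr addn.
by apply: eq_bigl => i; rewrite -val_eqE /= ltnS ltn_neqAle andbC.
Qed.

(** Either some bracket with k_j = 1 is [0] and both sides vanish, or every integer N + (s-1) K is
    nonnegative, truncation is harmless and the products agree factor by factor. *)
Lemma word_weightE (a l : nat) (k : 'I_l -> nat) (x : l.-tuple 'I_a.+1) :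
  (forall j, (k j <= 1)%N) -> x \in Iseq a l ->
  p ^ Pstar k * (q ^ Qstar s (nvec x) k * Acoef s p q (nvec x) k) =
  word_weight k (map val x).
Proof.
move=> k_le1 xI.
pose N t := (\sum_(i < l | (i < t)%N) nvec x i)%N.
pose K t := (\sum_(i < l | (i < t)%N) k i)%N.
have NE (j : 'I_l) : nth 0%N (map val x) (l - j.+1) = N j.+1.
  have lj := ltn_ord j.
  by rewrite /N sum_nvec // (nth_map ord0) // size_tuple; lia.
have sumZ (Q : pred 'I_l) (f : 'I_l -> nat) :
    \sum_(i | Q i) (f i)%:Z = (\sum_(i | Q i) f i)%N%:Z.
  by rewrite -(big_morph Posz PoszD (erefl 0%:Z)).
have PE : Pstar k = (\sum_(j < l) (1 - k j) * K j)%N.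
  rewrite /Pstar -sumZ; apply: eq_bigr => j _; rewrite sumZ -/(K j).
  by have := k_le1 j; nia.
have AE : Acoef s p q (nvec x) k = \prod_(j < l)
    if k j == 0%N then 1 else pqbracket p q ((N j.+1)%:Z + (s%:Z - 1) * (K j)%:Z).
  apply: eq_bigr => j _; rewrite !sumZ; have := k_le1 j.
  case: (k j) => [|[|//]] _; first by rewrite big_ord0.
  by rewrite big_ord1 mulr0 addr0.
have [/existsP[j /andP[/eqP kj1 /eqP NK]]|no_zero] :=
    boolP [exists j : 'I_l, (k j == 1%N) && ((N j.+1)%:Z + (s%:Z - 1) * (K j)%:Z == 0)].
  rewrite AE (bigD1 j) //= kj1 NK /= pqnum0 mul0r !mulr0.
  rewrite /word_weight (bigD1 j) //= kj1 NE /pass_weight -/(K j) /=.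
  by rewrite (_ : _ - _ = 0)%N ?pqnum0 ?mul0r //; nia.
have NS (j : 'I_l) : (N j <= N j.+1)%N.
  by have := sum_ord_ltS (nvec x) j; rewrite -/(N j) -/(N j.+1); lia.
(* When k_j = 1, the bracket is nonnegative by induction and nonzero by [no_zero], which leaves room
   for one more Z. *)
have le_KN t : (t <= l)%N -> (K t <= N t + s * K t)%N.
  elim: t => [_|t IHt lt_tl]; first by rewrite /K big_pred0.
  have {}IHt := IHt (ltnW lt_tl); set j := Ordinal lt_tl.
  have /existsPn/(_ j) := no_zero; rewrite negb_and /=.
  have -> : K t.+1 = (k j + K t)%N by exact: (sum_ord_ltS _ j).
  have := NS j; rewrite /=; have := k_le1 j; case: (k j) => [|[|//]] _ /=; nia.
have eE (j : 'I_l) : (N j.+1)%:Z + (s%:Z - 1) * (K j)%:Z =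
    (N j.+1 + s * K j - K j)%N.
  by have := le_KN j (ltnW (ltn_ord j)); have := NS j; nia.
have QE : Qstar s (nvec x) k = (\sum_(j < l) (1 - k j) * (N j.+1 + s * K j - K j))%N.
  rewrite /Qstar -sumZ; apply: eq_bigr => j _; rewrite !sumZ -/(K j) -/(N j.+1).
  by rewrite eE; have := k_le1 j; case: (k j) => [|[|//]] _ /=; lia.
rewrite PE QE AE -!exprnP -!prodrXr -!big_split /=; apply: eq_bigr => j _.
rewrite NE /pass_weight -/(K j) eE; have := k_le1 j.
by case: (k j) => [|[|//]] _ /=; rewrite ?mul1n ?mulr1 ?mul0n ?mul1r.
Qed.

(* Jcoef indexed by the number a = m - l of letters Y (GcoefE); unlike Jcoef it
   vanishes for l = 0 < k, so that Gcoef_rec holds for all k. *)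
Definition Gcoef (a l k : nat) : C :=
  \sum_(kk : {ffun 'I_l -> 'I_2} | (\sum_(j < l) kk j)%N == k)
    rsum l a (word_weight (fun j => kk j)).

Lemma Gcoef0 (a k : nat) : Gcoef a 0 k = (k == 0%N)%:R.
Proof.
rewrite /Gcoef big_mkcond (big_pred1 [ffun j : 'I_0 => ord0]); last first.
  by move=> kk; apply/esym/eqP/ffunP; case.
by rewrite big_ord0 eq_sym; case: eqP => //= _; rewrite /word_weight big_ord0.
Qed.

Lemma GcoefE (m l k : nat) : (k <= l)%N -> Jcoef s p q m l k = Gcoef (m - l) l k.
Proof.
rewrite /Jcoef; case: eqP => [->|_ _].
  by rewrite leqn0 => /eqP ->; rewrite Gcoef0.
apply: eq_bigr => kk _; rewrite big_distrr -sum_Iseq; apply: eq_bigr => x xI.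
by rewrite /= word_weightE // => j; rewrite -ltnS.
Qed.

Lemma Gcoef_gt (a l k : nat) : (l < k)%N -> Gcoef a l k = 0.
Proof.
move=> ltlk; rewrite /Gcoef big_pred0 // => kk; apply/negP => /eqP skk.
move: ltlk; rewrite -skk ltnNge => /negP; apply.
rewrite -[X in (_ <= X)%N]card_ord -sum1_card.
by apply: leq_sum => j _; rewrite -ltnS.
Qed.

Lemma Gcoef_eq0 (a l k : nat) : (a + s * k < k)%N -> Gcoef a l k = 0.
Proof.
move=> neg; have [lekl|] := leqP k l; last exact: Gcoef_gt.
by rewrite -(addnK l a) -GcoefE // Jcoef_eq0 // addnK; nia.
Qed.

(** Up to h^k, the coefficient at Z^k after X crosses the words with [t] letters Y and [l] letters
    X: it survives, or raises the power of Z from k - 1 to k. *)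
Definition Gstep (t l k : nat) : C :=
  p ^+ k * q ^+ (t + s * k - k) * Gcoef t l k +
  (if k is k'.+1 then pqnum p q (t + s * k' - k') * Gcoef t l k' else 0).

(** The first entry of lambda and the last coordinate e of the vector k belong to the same X, the
    leftmost one; e = 0 and e = 1 give the two terms of [Gstep]. *)
Lemma Gcoef_rec (a l k : nat) : Gcoef a l.+1 k = \sum_(t < a.+1) Gstep t l k.
Proof.
rewrite /Gcoef sum_ffun_recr /=.
under eq_bigr => e _ do rewrite exchange_big /=.
rewrite exchange_big /=; apply: eq_bigr => t _.
have step (e : 'I_2) :
  \sum_(g : {ffun 'I_l -> 'I_2} |
      (\sum_(j < l.+1) ffun_rcons g e j)%N == k)
    rsum l t (fun x => word_weight (fun j => ffun_rcons g e j) (val t :: x)) =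
  \sum_(g : {ffun 'I_l -> 'I_2} | (e + \sum_j g j)%N == k)
    rsum l t (word_weight (fun j => g j)) * pass_weight e (k - e) t.
  have sumE (g : {ffun 'I_l -> 'I_2}) :
      (\sum_(j < l.+1) ffun_rcons g e j = e + \sum_j g j)%N.
    rewrite big_ord_recr /= ffun_rcons_max addnC.
    by under eq_bigr => j _ do rewrite lift_max_widen ffun_rcons_lift.
  apply: eq_big => [g|g /eqP]; rewrite sumE // => gk.
  rewrite -rsum_mulr; apply: eq_rsum => x.
  rewrite word_weightS ffun_rcons_max -gk addKn; congr (_ * pass_weight _ _ _).
    rewrite /word_weight; apply: eq_bigr => j _; rewrite ffun_rcons_lift.
    by under eq_bigr => i _ do rewrite ffun_rcons_lift.
  by apply: eq_bigr => j _; rewrite ffun_rcons_lift.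
under eq_bigr => e _ do rewrite step -big_distrl /=.
rewrite big_ord_recr big_ord1 /= /Gstep /Gcoef; congr (_ + _).
  by rewrite subn0 mulrC.
(* For k = 0 no vector has e = 1, so the truncated [0 - 1] is harmless. *)
case: k {step} => [|k]; first by rewrite big_pred0 ?mul0r.
by rewrite subn1 mulrC.
Qed.

End Weights.

(** * Normal ordering of the sums of words and of the binomial *)

Section NormalOrdering.
Variables (C : fieldType) (A : algType C) (s : nat) (h p q : C) (X Y Z : A).
Hypothesis rel : gweyl_rel s h p q X Y Z.

Let mon (a l k : nat) : A := Y ^+ (a + s * k - k) * Z ^+ k * X ^+ (l - k).

(* The sum of all words with l letters X and a letters Y, in normal order. *)
Let part (a l : nat) : A :=
  \sum_(k < l.+1) (h ^+ k * Gcoef s p q a l k) *: mon a l k.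

Let stepped (a l : nat) : A :=
  \sum_(k < l.+2) (h ^+ k * Gstep s p q a l k) *: mon a l.+1 k.

Lemma Y_part (a l : nat) :
  Y * part a l = \sum_(k < l.+1) (h ^+ k * Gcoef s p q a l k) *: mon a.+1 l k.
Proof.
rewrite big_distrr; apply: eq_bigr => k _ /=.
(* Truncation would spoil the shift of a negative exponent of Y, but its coefficient is zero. *)
have [neg|nneg] := ltnP (a + s * k)%N k.
  by rewrite Gcoef_eq0 // mulr0 !scale0r mulr0.
by rewrite -scalerAr /mon !mulrA -exprS addSn subSn.
Qed.

Lemma X_part (a l : nat) : X * part a l = stepped a l.
Proof.
rewrite /stepped /Gstep.
under eq_bigr => k _ do rewrite mulrDr scalerDl.
(* Surviving X gives nothing at k = l + 1, and a new Z nothing at k = 0; without these terms both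
   sums run over the summands of [part a l]. *)
rewrite big_split /= big_ord_recr /= Gcoef_gt // !mulr0 scale0r addr0.
rewrite [X in _ = _ + X]big_ord_recl /= mulr0 scale0r add0r -big_split /=.
rewrite big_distrr; apply: eq_bigr => k _ /=.
have [neg|nneg] := ltnP (a + s * k)%N k.
  by rewrite Gcoef_eq0 // !mulr0 !scale0r mulr0 addr0.
rewrite -scalerAr /mon (gweyl_X_monomial rel) scalerDr !scalerA.
have le_kl : (k <= l)%N by rewrite -ltnS.
rewrite (subSn le_kl) subSS; congr (_ *: _ + _).
  by rewrite -!mulrA (mulrC (Gcoef _ _ _ _ _ _)) -!mulrA.
set c := pqnum p q _.
rewrite /bump /= add1n.
(* A zero exponent makes the bracket [0]; a positive one makes the predecessor in [gweyl_X_monomial]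
   exact. *)
have [e0|e_gt0] := posnP (a + s * k - k)%N.
  by rewrite /c e0 pqnum0 !(mulr0, mul0r) !scale0r.
congr (_ *: (Y ^+ _ * _ * _)); last by nia.
by rewrite add0n exprSr -!mulrA (mulrC (Gcoef _ _ _ _ _ _)) -!mulrA.
Qed.

Lemma partS0 (a : nat) : part a.+1 0 = Y * part a 0.
Proof. by rewrite Y_part; apply: eq_bigr => k _; rewrite !Gcoef0. Qed.

Lemma part0S (l : nat) : part 0 l.+1 = X * part 0 l.
Proof. by rewrite X_part; apply: eq_bigr => k _; rewrite Gcoef_rec big_ord1. Qed.

(** In [Gcoef_rec] the top term t = a + 1 accounts for the words starting with X, and the terms t <=
    a recombine to those starting with Y. *)
Lemma partSS (a l : nat) : part a.+1 l.+1 = Y * part a l.+1 + X * part a.+1 l.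
Proof.
rewrite X_part Y_part -big_split; apply: eq_bigr => k _ /=.
by rewrite -scalerDl -mulrDr !Gcoef_rec big_ord_recr.
Qed.

Lemma exprD_parts (m : nat) : (X + Y) ^+ m = \sum_(l < m.+1) part (m - l) l.
Proof.
elim: m => [|m IHm].
  by rewrite big_ord1 /part big_ord1 Gcoef0 /mon muln0 !mulr1 scale1r.
rewrite exprS {}IHm mulrDl addrC !big_distrr /=.
(* As in Pascal's rule, l = 0 arises only from Y and l = m + 1 only from X; every other part arises
   from both. *)
rewrite big_ord_recl [RHS]big_ord_recl /= !subn0 partS0 -addrA; congr (_ + _).
rewrite [in RHS]big_ord_recr [X in _ + X = _]big_ord_recr /= /bump /=.
rewrite !add1n !subnn part0S addrA; congr (_ + _).
rewrite -big_split; apply: eq_bigr => l _ /=.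
rewrite subSS /bump /= add1n.
have -> : (m - l = (m - l.+1).+1)%N by have := ltn_ord l; lia.
by rewrite partSS.
Qed.

Lemma exprD_normal_ordering (m : nat) :
  (X + Y) ^+ m =
    \sum_(l < m.+1) \sum_(k < l.+1)
      (h ^+ k * Jcoef s p q m l k) *:
        (Y ^+ (m - l + s * k - k) * Z ^+ k * X ^+ (l - k)).
Proof.
rewrite exprD_parts; apply: eq_bigr => l _; apply: eq_bigr => k _.
by rewrite GcoefE // -ltnS.
Qed.

End NormalOrdering.

Theorem theorem3p3 (R : realType) (A : algType R[i]) (s : nat) (h p q : R[i])
    (X Y Z : A) (m : nat) :
  h != 0 -> gweyl_rel s h p q X Y Z -> (0 < m)%N ->
  (X + Y) ^+ m =
    \sum_(l < m.+1) \sum_(k < l.+1)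
      (h ^+ k * Jcoef s p q m l k) *:
        (Y ^+ (m - l + s * k - k) * Z ^+ k * X ^+ (l - k)).
Proof. by move=> _ rel _; apply: exprD_normal_ordering. Qed.
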